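(* Consider the sequence of linear regression models, the random scales $s_n$ with $s_n \to s_0>0$ in probability, the loss $\rho_1$ and the redescending M-estimator $\hat{\boldsymbol\beta}=\arg\min_{\boldsymbol\beta\in\mathbb{R}^p}\sum_{i=1}^n\rho_1\big((y_i-\mathbf{x}_i^T\boldsymbol\beta)/s_n\big)$ described in the context. Assume: (1) $\rho_1$ is a continuously differentiable, bounded $\rho$-function with derivative $\psi_1=\rho_1'$, and $\psi_1(t)$ and $t\psi_1(t)$ are bounded functions of $t\in\mathbb{R}$; (2) the error distribution $F_0$ has a density $f_0$ that is even, a monotone decreasing function of $|u|$, and a strictly decreasing function of $|u|$ in a neighbourhood of $0$; (3) $p/n\to 0$ as $n\to\infty$. Then, for any $0<\alpha<1$, $$\eta_n(\alpha)\,\Vert\hat{\boldsymbol\beta}-\boldsymbol\beta_0\Vert\to 0\quad\text{in probability as } n\to\infty,$$ where $$\eta_n(\alpha)=\min_{\mathcal{A}\subset\{1,\dots,n\},\ \#\mathcal{A}=[n\alpha]}\ \min_{\Vert\theta\Vert=1}\ \max_{i\in\mathcal{A}}|\mathbf{x}_i^T\theta| .$$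
   Context: Model: for each $n$, $y_i=\mathbf{x}_i^T\boldsymbol\beta_0+u_i$, $1\le i\le n$, where $p=p_n$ may depend on $n$ (and may tend to infinity), $\mathbf{x}_i=\mathbf{x}_{i,n}\in\mathbb{R}^{p}$ are fixed (non-random) vectors, $\boldsymbol\beta_0=\boldsymbol\beta_{0,n}\in\mathbb{R}^{p}$ is the unknown parameter, and $u_i=u_{i,n}$ are i.i.d. random variables defined on a common probability space with distribution function $F_0$ (not depending on $n$). The matrix $\boldsymbol\Sigma_n=\frac1n\sum_{i=1}^n\mathbf{x}_i\mathbf{x}_i^T$ is assumed non-singular for all $n$. $s_n$ is a positive random variable defined on the same probability space as the errors, and $s_n\to s_0$ in probability for some constant $s_0>0$. $\hat{\boldsymbol\beta}$ is a (random) minimizer of the displayed objective over $\mathbb{R}^p$, assumed to exist. A function $\rho:\mathbb{R}\to\mathbb{R}$ is called a $\rho$-function if: $\rho$ is even and continuous; $\rho(x)$ is a nondecreasing function of $|x|$; $\rho(0)=0$; if $\rho(v)<\lim_{x\to\infty}\rho(x)$ and $0\le u<v$ then $\rho(u)<\rho(v)$; and, if $\rho$ is bounded, $\lim_{x\to\infty}\rho(x)=1$. $[x]$ denotes the integer part of $x$, $\#$ is cardinality, and $\Vert\cdot\Vert$ is the Euclidean norm. *)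

(* Defs.v *)
From HB Require Import structures.
From mathcomp Require Import all_boot all_order all_algebra.
From mathcomp Require Import all_classical all_reals all_analysis.
Import Order.TTheory GRing.Theory Num.Theory.
Import numFieldNormedType.Exports.

Set Implicit Arguments.
Unset Strict Implicit.
Unset Printing Implicit Defensive.

Local Open Scope classical_set_scope.
Local Open Scope ring_scope.

(* The limit at infinity is taken in \bar R, since rho may be unbounded. *)
Record rho_function (R : realType) (rho : R -> R) : Prop := RhoFunction {
  rho_even : forall x : R, rho (- x) = rho x;
  rho_continuous : continuous rho;
  rho_nondecreasing : forall x y : R, `|x| <= `|y| -> rho x <= rho y;
  rho_at0 : rho 0 = 0;
  rho_strict : forall u v : R,
    ((rho v)%:E < lim ((rho x)%:E @[x --> +oo%R]))%E ->
    0 <= u -> u < v -> rho u < rho v;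
  rho_normalized : bounded_fun rho -> rho x @[x --> +oo] --> (1 : R)
}.

Definition continuously_differentiable (R : realType) (f : R -> R) : Prop :=
  (forall x : R, derivable f x 1) /\ continuous (derive1 f).

(* The norm that the library puts on matrices is the sup norm. *)
Definition enorm (R : realType) (p : nat) (v : 'cV[R]_p) : R :=
  Num.sqrt (\sum_(j < p) v j 0 ^+ 2).

Definition dotv (R : realType) (p : nat) (a b : 'cV[R]_p) : R :=
  (a^T *m b) 0 0.

Definition design_cov (R : realType) (n p : nat) (x : 'I_n -> 'cV[R]_p) :
    'M[R]_p :=
  n%:R^-1 *: \sum_(i < n) (x i *m (x i)^T).

Definition m_objective (R : realType) (n p : nat) (rho : R -> R)
    (x : 'I_n -> 'cV[R]_p) (y : 'I_n -> R) (s : R) (b : 'cV[R]_p) : R :=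
  \sum_(i < n) rho ((y i - dotv (x i) b) / s).

Definition is_minimizer (R : realType) (T : Type) (f : T -> R) (t : T) : Prop :=
  forall t', f t <= f t'.

(* Both infima are minima when 0 < p and 0 <= alpha <= 1: the inner one is over
   a compact sphere, the outer one over a nonempty finite set. All terms of
   the maximum are nonnegative, so 0 is a neutral default value. *)
Definition eta_n (R : realType) (n p : nat) (x : 'I_n -> 'cV[R]_p) (alpha : R) :
    R :=
  inf [set inf [set \big[Num.max/0]_(i in A) `|dotv (x i) theta|
               | theta in [set theta : 'cV[R]_p | enorm theta = 1]]
      | A in [set A : {set 'I_n} | #|A| = Num.truncn (n%:R * alpha)]].

Definition mutually_independent (d : measure_display) (T : measurableType d)
    (R : realType) (P : probability T R) (I : finType)
    (X : I -> {RV P >-> R}) : Prop :=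
  forall (J : {set I}) (B : I -> set R), (forall i, measurable (B i)) ->
    fine (P [set w | forall i, i \in J -> B i (X i w)]) =
    \prod_(i in J) fine (P (X i @^-1` B i)).

Definition iid (d : measure_display) (T : measurableType d)
    (R : realType) (P : probability T R) (I : finType)
    (X : I -> {RV P >-> R}) (F : R -> R) : Prop :=
  mutually_independent X /\ forall i r, cdf (X i) r = (F r)%:E.

Definition has_density (R : realType) (F f : R -> R) : Prop :=
  [/\ measurable_fun setT f,
      forall t, 0 <= f t &
      forall r, (F r)%:E = (\int[lebesgue_measure]_(t in `]-oo, r]) (f t)%:E)%E].

Definition even_unimodal (R : realType) (f : R -> R) : Prop :=
  [/\ forall t, f (- t) = f t,
      forall s t : R, `|s| <= `|t| -> f t <= f s &
      exists2 delta, 0 < delta &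
        forall s t : R, `|s| < `|t| -> `|t| < delta -> f t < f s].

Definition random_vector (d : measure_display) (T : measurableType d)
    (R : realType) (p : nat) (b : T -> 'cV[R]_p) : Prop :=
  forall j, measurable_fun setT (fun w => b w j 0).

Definition cvg_in_probability (d : measure_display) (T : measurableType d)
    (R : realType) (P : probability T R) (X : nat -> T -> R) (l : R) : Prop :=
  forall e : R, 0 < e -> P [set w | e < `|X n w - l|] @[n --> \oo] --> 0%E.

(* Main.v *)
Require Import Defs.
From HB Require Import structures.
From mathcomp Require Import all_boot all_order all_algebra.
From mathcomp Require Import all_classical all_reals all_analysis.
From mathcomp Require Import measurable_realfun.
From mathcomp Require Import ring lra.
Import Order.TTheory GRing.Theory Num.Theory.
Import numFieldNormedType.Exports.

(** Write v = betahat - beta0 and t_i = x_i . v.  Since betahat minimizes the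
    objective, the residuals u_i - t_i have a total loss at most that of the
    errors u_i.  If eta_n * ||v|| > e, then |t_i| >= e for at least a
    proportion 1 - alpha of the indices (eta_n_large), and the proof shows that
    with high probability such a v has a strictly larger loss than v = 0.

    Averaging indicators of superlevel sets (layer_cake), a rho-function is,
    up to an error of one level, a mean of finitely many functions
    1{a_k <= |v|}.  So losses may be replaced by the numbers of indices with
    |u_i - t_i| >= b, for finitely many thresholds b = s_n * a_k, and s_n may
    be replaced by s0 because the density is bounded.

    For one threshold, the expected number of exceedances is the sum of the
    1 - window F b t_i, where window F b t is the mass of [t - b, t + b].  The
    density is even and unimodal, so the window of half-width b has most mass
    when it is centred at 0 (window_centred); for b close to a small e it loses
    a fixed amount as soon as |t| >= e (window_gap), by strict monotonicity of
    the density near 0.  Strict monotonicity of rho near 0 ensures that a fixed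
    proportion of the levels has such a b (levels_between).  Hence the expected
    losses differ by a fixed multiple of n.

    It remains to compare counts with their expectations uniformly in v.  Only
    the cells of a finite grid that contain the t_i matter (brackets), and the
    vectors of cells that occur are sign patterns of n K affine forms in p
    variables.  By Pajor's form of the Sauer-Shelah lemma (pajor) and the fact
    that affine forms on R^p shatter at most p + 1 points, there are at most
    exp (o(n)) of them when p / n -> 0, while a Chernoff bound makes each one
    exceptional with probability at most exp (- n e^2 / 4).  The union bound
    gives uniform_law. *)

Set Implicit Arguments.
Unset Strict Implicit.
Unset Printing Implicit Defensive.

Local Open Scope ring_scope.

(** * Sign patterns of affine forms *)

Definition shatters (T : finType) (F : {set {set T}}) (S : {set T}) : bool :=
  [forall B : {set T}, (B \subset S) ==> [exists A in F, A :&: S == B]].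

Lemma shattersP (T : finType) (F : {set {set T}}) (S : {set T}) :
  reflect (forall B : {set T}, B \subset S -> exists2 A, A \in F & A :&: S = B)
          (shatters F S).
Proof.
apply: (iffP forallP) => [h B BS|h B].
  have := h B; rewrite BS => /exists_inP[A AF /eqP AB]; by exists A.
by apply/implyP => /h[A AF AB]; apply/exists_inP; exists A => //; apply/eqP.
Qed.

(** A family shatters at least as many sets as it has members.  Induction on the
    ground set: split the family by membership of a point x.  A set shattered by
    both halves is counted twice, and then its union with x is shattered too. *)
Lemma pajor (T : finType) (D : {set T}) (F : {set {set T}}) :
  (forall A, A \in F -> A \subset D) ->
  (#|F| <= #|[set S : {set T} | (S \subset D) && shatters F S]|)%N.
Proof.
have [k] := ubnP #|D|; elim: k D F => // k IH D F Dk FD.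
have [D0|[x xD]] := finset.set_0Vmem D.
  have [->|[A AF]] := finset.set_0Vmem F; first by rewrite cards0.
  have F0 B : B \in F -> B = finset.set0.
    by move=> /FD; rewrite D0 finset.subset0 => /eqP.
  apply: (@leq_trans #|[set (finset.set0 : {set T})]|).
    by apply/subset_leq_card/fintype.subsetP => B /F0 ->; rewrite inE.
  apply/subset_leq_card/fintype.subsetP => B; rewrite !inE => /eqP ->.
  rewrite finset.sub0set; apply/shattersP => B';
    rewrite finset.subset0 => /eqP ->.
  by exists A => //; rewrite finset.setI0.
pose F0 := [set A in F | x \notin A].
pose F1 := [set A :\ x | A in [set A in F | x \in A]].
pose sh (G : {set {set T}}) := [set S : {set T} | (S \subset D :\ x) &&
  shatters G S].
have D'k : (#|D :\ x| < k)%N by rewrite (cardsD1 x) xD in Dk.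
have cF : (#|F| = #|F0| + #|F1|)%N.
  rewrite card_in_imset.
    rewrite addnC -cardsUI (_ : _ :&: _ = finset.set0) ?cards0 ?addn0.
      by apply: eq_card => A; rewrite !inE; case: (A \in F); case: (x \in A).
    by apply/finset.setP => A; rewrite !inE; case: (A \in F); case: (x \in A).
  move=> A B; rewrite !inE => /andP[_ xA] /andP[_ xB] AB.
  by rewrite -(finset.setD1K xA) AB finset.setD1K.
have c0 : (#|F0| <= #|sh F0|)%N.
  apply: IH => // A; rewrite inE => /andP[/FD AD xA].
  by rewrite finset.subsetD1 AD.
have c1 : (#|F1| <= #|sh F1|)%N.
  apply: IH => // A /imsetP[B]; rewrite inE => /andP[/FD BD xB ->].
  by rewrite finset.setSD.
rewrite cF; apply: (leq_trans (leq_add c0 c1)).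
rewrite -cardsUI.
have xS G S : S \in sh G -> x \notin S.
  by rewrite inE finset.subsetD1 => /andP[/andP[]].
have -> : #|sh F0 :&: sh F1| = #|[set x |: S | S in sh F0 :&: sh F1]|.
  rewrite card_in_imset // => A B;
    rewrite !finset.in_setI => /andP[/xS xA _] /andP[/xS xB _] AB.
  by rewrite -(finset.setU1K xA) AB finset.setU1K.
rewrite -cardsUI [X in (_ + X)%N](_ : _ = 0%N) ?addn0; last first.
  apply/eqP; rewrite cards_eq0; apply/eqP/finset.setP => S;
    rewrite finset.in_set0.
  apply/negP; rewrite finset.in_setI => /andP[SU /imsetP[B _ SB]].
  move: SU; rewrite finset.in_setU => /orP[] /xS; by rewrite SB finset.setU11.
apply/subset_leq_card/fintype.subsetP => S;
  rewrite finset.in_setU finset.in_setU => /orP[/orP[]|].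
- rewrite !inE => /andP[SD /shattersP h];
  rewrite (fintype.subset_trans SD (finset.subD1set _ _)) /=.
  apply/shattersP => B /h[A]; rewrite inE => /andP[AF _] AB; by exists A.
- rewrite !inE => /andP[SD /shattersP h];
  rewrite (fintype.subset_trans SD (finset.subD1set _ _)) /=.
  have xnS : x \notin S by move: SD; rewrite finset.subsetD1 => /andP[].
  apply/shattersP => B /h[A /imsetP[A']]; rewrite inE => /andP[A'F _] -> <-.
  exists A' => //; apply/finset.setP => z; rewrite !inE.
  by case: eqP => [->|//]; rewrite (negbTE xnS) andbF.
- move=> /imsetP[S']; rewrite finset.in_setI !inE.
  move=> /andP[/andP[S'D /shattersP h0] /andP[_ /shattersP h1]] ->.
  have xnS : x \notin S' by move: S'D; rewrite finset.subsetD1 => /andP[].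
  rewrite finset.subUset finset.sub1set xD (fintype.subset_trans S'D
    (finset.subD1set _ _)) /=.
  apply/shattersP => B BS; have [xB|xB] := boolP (x \in B).
    have /h1[A /imsetP[A']] : B :\ x \subset S'.
      by rewrite finset.subDset.
    rewrite inE => /andP[A'F xA'] -> AB; exists A' => //.
    apply/finset.setP => z; move/finset.setP/(_ z): AB; rewrite !inE.
    by case: eqP => [->|//]; rewrite xA' xB.
  have /h0[A] : B \subset S'.
    apply/fintype.subsetP => z zB; move/fintype.subsetP/(_ z zB): BS.
    by rewrite !inE; case: eqP => // zx; rewrite -zx zB in xB.
  rewrite inE => /andP[AF xA] AB; exists A => //.
  apply/finset.setP => z; move/finset.setP/(_ z): AB; rewrite !inE.
  by case: eqP => [->|//]; rewrite (negbTE xA) (negbTE xB).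
Qed.

(** Among more than q + 1 forms b |-> z_j . b - c_j there is a nontrivial linear
    relation sum_j v_j (z_j . b - c_j) = 0.  The sign pattern that agrees with
    the signs of the v_j would make this sum positive. *)
Lemma affine_not_shattered (R : realType) (q : nat) (T : finType)
    (z : T -> 'cV[R]_q) (c : T -> R) (F : {set {set T}}) (S : {set T}) :
  (forall A, A \in F -> exists b, A = [set j | c j <= dotv (z j) b]%SET) ->
  shatters F S -> (#|S| <= q.+1)%N.
Proof.
move=> hF /shattersP hS; rewrite leqNgt; apply/negP => qS.
(* the rows (z_j, c_j) are more numerous than their q + 1 coordinates *)
pose M : 'M[R]_(#|S|, q + 1) :=
  \matrix_(i, k) (row_mx (z (enum_val i))^T (c (enum_val i))%:M) 0 k.
have : kermx M != 0.
  rewrite kermx_eq0; apply/negP => /eqP fM.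
  by have := rank_leq_col M; rewrite fM leqNgt addn1 qS.
case/rowV0Pn => v0 /sub_kermxP v0M v0n0.
have hv0 b : \sum_(i < #|S|) v0 0 i *
    (dotv (z (enum_val i)) b - c (enum_val i)) = 0.
  have Mb i : (M *m col_mx b (- 1%:M)) i 0
      = dotv (z (enum_val i)) b - c (enum_val i).
    rewrite -[LHS](_ : row i (M *m col_mx b (- 1%:M)) 0 0 = _);
      last by rewrite [LHS]mxE.
    rewrite row_mul.
    have -> : row i M = row_mx (z (enum_val i))^T (c (enum_val i))%:M.
      by apply/rowP => k; rewrite !mxE.
    rewrite mul_row_col mulmxN mulmx1 [LHS]mxE; congr (_ + _).
    by rewrite !mxE eqxx mulr1n.
  have : v0 *m M *m col_mx b (- 1%:M) = 0 by rewrite v0M mul0mx.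
  rewrite -mulmxA => /matrixP/(_ 0 0); rewrite [LHS]mxE [RHS]mxE => E.
  by rewrite -[RHS]E; apply: eq_bigr => i _; rewrite Mb.
(* up to the sign of the relation, some coefficient is negative, which makes
   the inequality below strict *)
have [v hv [i0 vi0]] : exists2 v : 'rV[R]_#|S|,
    (forall b, \sum_(i < #|S|) v 0 i *
      (dotv (z (enum_val i)) b - c (enum_val i)) = 0)
    & exists i0, v 0 i0 < 0.
  case/rV0Pn: v0n0 => i0; rewrite neq_lt => /orP[vi|vi].
    by exists v0 => //; exists i0.
  exists (- v0); last by exists i0; rewrite mxE oppr_lt0.
  move=> b; under eq_bigr do rewrite mxE mulNr.
  by rewrite sumrN hv0 oppr0.
have [A /hF[b Ab] AS] := hS [set enum_val i | i in [pred i | 0 <= v 0 i]]%SET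
  ltac:(by apply/fintype.subsetP => j /imsetP[i _ ->]; exact: enum_valP).
have mA i : (c (enum_val i) <= dotv (z (enum_val i)) b) = (0 <= v 0 i).
  have := AS => /finset.setP/(_ (enum_val i));
    rewrite Ab !inE enum_valP andbT => ->.
  apply/imsetP/idP => [[i' hi' /enum_val_inj ->] //|h]; by exists i.
have := hv b; apply/eqP; rewrite gt_eqF //.
rewrite (bigD1 i0) //= ltr_wpDr //.
  apply: sumr_ge0 => i _; case: (leP 0 (v 0 i)) => [vi|vi].
    by rewrite mulr_ge0 // subr_ge0 mA.
  rewrite mulr_le0 ?(ltW vi) // subr_le0 ltW // ltNge mA -ltNge //.
by rewrite nmulr_lgt0 // subr_lt0 ltNge mA -ltNge.
Qed.

(** Weigh each set S by lam ^ #|S|: the total weight is (1 + lam) ^ #|T|, and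
    each set of size at most q has weight at least lam ^ q. *)
Lemma card_small_subsets (R : realType) (T : finType) (q : nat) (lam : R) :
  0 < lam -> lam <= 1 ->
  #|[set S : {set T} | (#|S| <= q)%N]%SET|%:R <=
    expR (q%:R * ln lam^-1 + lam * #|T|%:R).
Proof.
move=> l0 l1.
have E : \sum_(S : {set T}) lam ^+ #|S| = (1 + lam) ^+ #|T|.
  transitivity (\prod_(i : T) (lam + 1)).
    rewrite bigA_distr; apply: eq_bigr => S _.
    by rewrite -big_mkcond /= prodr_const.
  by rewrite prodr_const addrC.
have lq : expR (q%:R * ln lam^-1) = lam ^- q.
  by rewrite expRM_natl lnK ?posrE ?invr_gt0 // exprVn.
rewrite expRD lq ler_pdivlMl ?exprn_gt0 // mulrC.
apply: (@le_trans _ _ ((1 + lam) ^+ #|T|)); last first.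
  rewrite mulrC expRM_natl lerXn2r ?nnegrE ?expR_ge0 ?addr_ge0 ?(ltW l0) //.
  by rewrite expR_ge1Dx.
rewrite -E (bigID [in [set S : {set T} | (#|S| <= q)%N]%SET]) /=.
rewrite -[leLHS]addr0 lerD ?sumr_ge0 // => [|i _];
  last by rewrite exprn_ge0 ?ltW.
rewrite mulrC mulr_natr -sumr_const ler_sum // => S; rewrite inE => Sq.
by rewrite ler_wiXn2l // ltW.
Qed.

(** By pajor, a family that shatters only sets of at most q + 1 points has no
    more members than there are such sets.  If q is small compared with #|T|, a
    suitable small lam makes the exponent small compared with #|T| too. *)
Lemma card_halfspace_patterns (R : realType) (q : nat) (T : finType)
    (z : T -> 'cV[R]_q) (c : T -> R) (F : {set {set T}}) (lam : R) :
  (forall A, A \in F -> exists b, A = [set j | c j <= dotv (z j) b]%SET) ->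
  0 < lam -> lam <= 1 ->
  #|F|%:R <= expR (q.+1%:R * ln lam^-1 + lam * #|T|%:R).
Proof.
move=> hF l0 l1; apply: le_trans (card_small_subsets _ _ l0 l1).
rewrite ler_nat; apply: (leq_trans (@pajor _ [set: T]%SET F _)) => [A _|].
  exact: finset.subsetT.
apply/subset_leq_card/fintype.subsetP => S; rewrite !inE => /andP[_].
exact: affine_not_shattered hF.
Qed.

Local Open Scope classical_set_scope.
Local Open Scope ring_scope.

(** * The loss as an average of exceedance indicators *)

Lemma sum_bool_le (R : numDomainType) (m : nat) (b : 'I_m -> bool) :
  \sum_(k < m) (b k)%:R <= m%:R :> R.
Proof.
rewrite -[m in leRHS]card_ord -sum1_card natr_sum ler_sum // => i _.
by case: (b i).
Qed.

Lemma count_levels_le (R : realDomainType) (z : R) (m : nat) : 0 <= z ->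
  \sum_(k < m) (k.+1%:R <= z)%R%:R <= z.
Proof.
move=> z0; elim: m => [|m IH]; first by rewrite big_ord0.
have [mz|mz] := leP (m.+1%:R) z; first exact: le_trans (sum_bool_le _ _) mz.
by rewrite big_ord_recr /= [_.+1%:R <= _]leNgt mz addr0.
Qed.

Lemma count_levels_ge (R : realDomainType) (z : R) (m : nat) : z <= m.+1%:R ->
  z <= \sum_(k < m) (k.+1%:R < z)%R%:R + 1.
Proof.
elim: m => [|m IH] zm; first by rewrite big_ord0 add0r.
have [mz|mz] := leP z (m.+1%:R).
  by rewrite big_ord_recr /= [_.+1%:R < _]ltNge mz addr0 IH.
apply: le_trans zm _; rewrite -[m.+2]addn1 natrD lerD2r.
rewrite (eq_bigr (fun=> 1)) ?sumr_const ?card_ord // => i _.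
by rewrite (le_lt_trans _ mz) // ler_nat.
Qed.

Section RhoFunction.
Variables (R : realType) (rho : R -> R).
Hypotheses (hrho : rho_function rho) (hb : bounded_fun rho).

Lemma rho_ge0 v : 0 <= rho v.
Proof.
by rewrite -(rho_at0 hrho); apply: (rho_nondecreasing hrho); rewrite normr0.
Qed.

Lemma rho_le1 v : rho v <= 1.
Proof.
have h := rho_normalized hrho hb.
rewrite leNgt; apply/negP => v1.
have [M [_ hM]] := cvgr_lt _ h _ v1.
have := hM (Num.max (M + 1) `|v|); rewrite lt_max ltrDl ltr01 => /(_ isT).
apply/negP; rewrite -leNgt; apply: (rho_nondecreasing hrho).
by rewrite (le_trans _ (ler_norm _)) // le_max lexx orbT.
Qed.

Lemma rho_surj z : 0 <= z -> z < 1 -> exists2 a, 0 <= a & rho a = z.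
Proof.
move=> z0 z1; have h := rho_normalized hrho hb.
have [M [_ hM]] := cvgr_gt _ h _ z1.
have : z < rho (Num.max (M + 1) 0) by apply: hM; rewrite lt_max ltrDl ltr01.
set c := Num.max _ _ => zc; have c0 : 0 <= c by rewrite le_max lexx orbT.
have [||a] := @IVT R rho 0 c z c0.
- exact/continuous_subspaceT/(rho_continuous hrho).
- by rewrite (rho_at0 hrho) ge_min z0 le_max (ltW zc) orbT.
by rewrite in_itv => /andP[a0 _] az; exists a.
Qed.

Lemma rho_increasing_near0 : exists2 delta, 0 < delta &
  forall u v, 0 <= u -> u < v -> v < delta -> rho u < rho v.
Proof.
have [||c c0 hc] := @rho_surj 2^-1; [lra|lra|].
have cp : 0 < c.
  rewrite lt_neqAle c0 andbT; apply/eqP => c0'.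
  by have := rho_at0 hrho; rewrite c0' hc; lra.
exists c => // u v u0 uv vc; apply: (rho_strict hrho) => //.
rewrite (_ : lim _ = 1%:E); last first.
  apply: cvg_lim => //; apply: cvg_EFin; first exact: nearW.
  exact: (rho_normalized hrho hb).
rewrite lte_fin; apply: (@le_lt_trans _ _ (rho c)); last by rewrite hc; lra.
by apply: (rho_nondecreasing hrho); rewrite !ger0_norm //; lra.
Qed.

(** With rho (a k) = (k + 1) / (m + 1), both counts compare the number
    (m + 1) * rho v with the integers 1, ..., m. *)
Lemma layer_cake (m : nat) : exists2 a : 'I_m -> R, (forall k, 0 < a k) &
  forall v, \sum_(k < m) (a k <= `|v|)%R%:R <= m.+1%:R * rho v
            <= \sum_(k < m) (a k <= `|v|)%R%:R + 1.
Proof.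
have m0 : 0 < m.+1%:R :> R by rewrite ltr0n.
have hk (k : 'I_m) : exists a, 0 < a /\ rho a = k.+1%:R / m.+1%:R.
  have [||a a0 ha] := @rho_surj (k.+1%:R / m.+1%:R).
  - by rewrite divr_ge0.
  - by rewrite ltr_pdivrMr // mul1r ltr_nat ltnS.
  exists a; split => //; rewrite lt_neqAle a0 andbT; apply/eqP => a0'.
  have := ha; rewrite -a0' (rho_at0 hrho) => /esym/eqP.
  by rewrite mulf_eq0 invr_eq0 !pnatr_eq0.
have [a ha] := choice hk; exists a => [k|v]; first by have [] := ha k.
have E k : m.+1%:R * rho (a k) = k.+1%:R.
  by have [_ ->] := ha k; rewrite mulrC divfK // gt_eqF.
have le_ak k : a k <= `|v| -> rho (a k) <= rho v.
  move=> h; apply: (rho_nondecreasing hrho); rewrite ger0_norm //.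
  by have [/ltW] := ha k.
apply/andP; split.
  apply: le_trans (@count_levels_le _ _ m _);
    last by rewrite mulr_ge0 ?rho_ge0 ?ler0n.
  apply: ler_sum => k _; case: (leP (a k)) => //= /le_ak h.
  by rewrite -E ler_pM2l // h.
apply: le_trans (@count_levels_ge _ _ m _) _.
  by rewrite ger_pMr // rho_le1.
rewrite lerD2r; apply: ler_sum => k _.
case: (leP (a k)) => //= h; first by case: (_ < _).
suff /le_gtF -> : m.+1%:R * rho v <= k.+1%:R by [].
rewrite -E ler_pM2l //; apply: (rho_nondecreasing hrho).
by rewrite [leRHS]ger0_norm ltW //; have [] := ha k.
Qed.

End RhoFunction.

(** * Windows under an even unimodal density *)

(** All that the window comparison needs to know about F as an integral of f.
    In this form it is stable under reflection, which avoids changes of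
    variables in integrals. *)
Definition increment_bounds (R : realType) (F f : R -> R) : Prop :=
  forall l r c C, l <= r -> 0 <= c ->
    (forall v, l <= v <= r -> c <= f v <= C) ->
    c * (r - l) <= F r - F l <= C * (r - l).

Lemma density_increments (R : realType) (F f : R -> R) :
  has_density F f -> increment_bounds F f.
Proof.
move=> [mf f0 hF] l r c C lr c0 hcC.
have mE (D : set R) : measurable_fun D (fun t : R => (f t)%:E).
  by apply/measurable_EFinP; exact: measurable_funTS.
have E : ((F r)%:E = (F l)%:E +
  \int[lebesgue_measure]_(t in `]l, r]) (f t)%:E)%E.
  rewrite !hF (_ : `]-oo, r]%classic = `]-oo, l]%classic `|` `]l, r]%classic);
    last first.
    by rewrite -itv_bndbnd_setU // bnd_simp.
  rewrite ge0_integral_setU //=; try exact: measurable_itv.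
  - exact: mE.
  - by move=> t _; rewrite lee_fin.
  - apply/disj_setPRL => t /=; rewrite !in_itv /= => /andP[lt _].
    by apply/negP; rewrite -ltNge.
have vol : lebesgue_measure `]l, r]%classic = (r - l)%:E.
  rewrite lebesgue_measure_itv /= lte_fin.
  move: lr; rewrite le_eqVlt => /orP[/eqP ->|->//].
  by rewrite ltxx subrr.
have C0 : 0 <= C by have /andP[h1 h2] := hcC l ltac:(by rewrite lexx); lra.
have lo : (c%:E * (r - l)%:E <=
  \int[lebesgue_measure]_(t in `]l, r]) (f t)%:E)%E.
  rewrite -vol -integral_cst; last exact: measurable_itv.
  apply: ge0_le_integral => //; try exact: measurable_itv.
  - exact: mE.
  - move=> t /=; rewrite in_itv /= => /andP[lt tr]; rewrite lee_fin.
    by have /andP[] := hcC t ltac:(by rewrite (ltW lt)).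
have hi : (\int[lebesgue_measure]_(t in `]l, r]) (f t)%:E <=
  C%:E * (r - l)%:E)%E.
  rewrite -vol -integral_cst; last exact: measurable_itv.
  apply: ge0_le_integral => //; try exact: measurable_itv.
  - by move=> t _; rewrite lee_fin.
  - exact: mE.
  - move=> t /=; rewrite in_itv /= => /andP[lt tr]; rewrite lee_fin.
    by have /andP[] := hcC t ltac:(by rewrite (ltW lt)).
have -> : (F r - F l)%R = fine (\int[lebesgue_measure]_(t in `]l, r]) (f t)%:E).
  move: E; case: integral => [s|//|//] /=.
  by rewrite -EFinD => -[->]; lra.
move: lo hi E; case: integral => [s|//|//] /=.
by rewrite -!EFinM !lee_fin => -> ->.
Qed.

(** The mass of the window of half-width b centred at t, when F is a continuous
    distribution function. *)
Definition window (R : realType) (F : R -> R) (b t : R) : R :=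
  F (t + b) - F (t - b).

Section Window.
Variables (R : realType) (F f : R -> R).
Hypotheses (hinc : increment_bounds F f) (hf : even_unimodal f).
Hypothesis f_ge0 : forall v, 0 <= f v.

Let f_le s t : `|s| <= `|t| -> f t <= f s.
Proof. by have [_ + _] := hf; apply. Qed.

Lemma increments_ge0 l r : l <= r -> 0 <= F r - F l.
Proof.
move=> lr; have := @hinc l r 0 (f 0) lr (lexx 0); rewrite mul0r => h.
by have /andP[] := h ltac:(by move=> v _; rewrite f_ge0 f_le // normr0).
Qed.

Lemma increments_le l r : l <= r -> F r - F l <= f 0 * (r - l).
Proof.
move=> lr; have := @hinc l r 0 (f 0) lr (lexx 0) => h.
by have /andP[] := h ltac:(by move=> v _; rewrite f_ge0 f_le // normr0).
Qed.

Lemma window_width b b' t : `|window F b' t - window F b t| <=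
  2 * f 0 * `|b' - b|.
Proof.
wlog bb : b b' / b <= b'.
  move=> h; have [/h//|/ltW/h] := leP b b'.
  by rewrite distrC [in leRHS]distrC.
have h1 := @increments_ge0 (t + b) (t + b') ltac:(lra).
have h2 := @increments_ge0 (t - b') (t - b) ltac:(lra).
have h3 := @increments_le (t + b) (t + b') ltac:(lra).
have h4 := @increments_le (t - b') (t - b) ltac:(lra).
have -> : 2 * f 0 * `|b' - b| = f 0 * (t + b' - (t + b)) +
  f 0 * (t - b - (t - b')).
  by rewrite ger0_norm; [ring|lra].
rewrite /window ger0_norm; lra.
Qed.

(** When t <= 2 * b, sliding the window from 0 to t trades the mass of
    [- b, t - b] for that of [b, t + b], where the density is at most f b.
    When t > 2 * b the two windows are disjoint, and the density is at most f b
    on the whole second window.  Hence the minimum m. *)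
Lemma window_slide b t k (m := Num.min t (2 * b)) : 0 <= t -> 0 < b ->
  f b * m + k <= F (m - b) - F (- b) -> window F b t + k <= window F b 0.
Proof.
move=> t0 b0; rewrite /m /window add0r sub0r; case: (leP t (2 * b)) => tb h.
  have /andP[_ h1] := @hinc b (t + b) 0 (f b) ltac:(lra) (lexx 0) ltac:(
    move=> v /andP[bv _]; rewrite f_ge0 f_le // !ger0_norm; lra).
  lra.
have /andP[_ h1] := @hinc (t - b) (t + b) 0 (f b) ltac:(lra) (lexx 0) ltac:(
    move=> v /andP[bv _]; rewrite f_ge0 f_le // !ger0_norm; lra).
have bb : 2 * b - b = b by ring.
rewrite bb in h; lra.
Qed.

Lemma window_centred_pos b t : 0 <= t -> 0 < b -> window F b t <= window F b 0.
Proof.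
move=> t0 b0; rewrite -[leLHS]addr0; apply: window_slide => //.
set m := Num.min _ _; have m0 : 0 <= m by rewrite le_min t0; lra.
have m2 : m <= 2 * b by rewrite ge_min lexx orbT.
have /andP[h1 _] := @hinc (- b) (m - b) (f b) (f 0) ltac:(lra) (f_ge0 _) ltac:(
  move=> v /andP[bv vb]; rewrite !f_le ?normr0 //;
  rewrite [leRHS]ger0_norm ?ler_norml; lra).
lra.
Qed.

(** On [e / 2 - b, e - b] the density is at least f (b - e / 2), hence at least
    f (3 / 4 * e), which exceeds f e >= f b: this piece of length e / 2 yields
    the gap, uniformly in b and t. *)
Lemma window_gap_pos e b t : 0 < e -> e <= t -> e <= b -> b <= 5 / 4 * e ->
  window F b t + e / 2 * (f (3 / 4 * e) - f e) <= window F b 0.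
Proof.
move=> e0 et eb be; have b0 : 0 < b by lra.
apply: window_slide => //; first lra.
set m := Num.min _ _; have m0 : e <= m by rewrite le_min et; lra.
have m2 : m <= 2 * b by rewrite ge_min lexx orbT.
have f0 v : f v <= f 0 by rewrite f_le // normr0.
have fbe : f b <= f e by rewrite f_le // !ger0_norm; lra.
have /andP[h1 _] := @hinc (- b) (e / 2 - b) (f b) (f 0) ltac:(lra) (f_ge0 _)
  ltac:(
  move=> v /andP[bv vb]; rewrite f0 f_le //;
  rewrite [leRHS]ger0_norm ?ler_norml; lra).
have /andP[h2 _] := @hinc (e / 2 - b) (e - b) (f (3 / 4 * e)) (f 0)
  ltac:(lra) (f_ge0 _) ltac:(
  move=> v /andP[bv vb]; rewrite f0 f_le //;
  rewrite [leRHS]ger0_norm ?ler_norml; lra).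
have /andP[h3 _] := @hinc (e - b) (m - b) (f b) (f 0) ltac:(lra) (f_ge0 _)
  ltac:(
  move=> v /andP[bv vb]; rewrite f0 f_le //;
  rewrite [leRHS]ger0_norm ?ler_norml; lra).
have h4 : e / 2 * f b <= e / 2 * f e by rewrite ler_pM2l //; lra.
have -> : F (m - b) - F (- b) = (F (m - b) - F (e - b)) +
  (F (e - b) - F (e / 2 - b)) + (F (e / 2 - b) - F (- b)) by ring.
apply: le_trans (lerD (lerD h3 h2) h1); lra.
Qed.

End Window.

Lemma window_reflect (R : realType) (F : R -> R) b t :
  window (fun x => - F (- x)) b t = window F b (- t).
Proof.
rewrite /window opprD opprB [b - t]addrC opprK; ring.
Qed.

Lemma increment_bounds_reflect (R : realType) (F f : R -> R) :
  even_unimodal f -> increment_bounds F f ->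
  increment_bounds (fun x => - F (- x)) f.
Proof.
move=> [ev _ _] h l r c C lr c0 hc.
have := @h (- r) (- l) c C ltac:(lra) c0.
have -> : - l - - r = r - l by ring.
have -> : - F (- r) - - F (- l) = F (- l) - F (- r) by ring.
apply => v /andP[rv vl]; rewrite -ev; apply: hc; lra.
Qed.

Section WindowBothSides.
Variables (R : realType) (F f : R -> R).
Hypotheses (hinc : increment_bounds F f) (hf : even_unimodal f).
Hypothesis f_ge0 : forall v, 0 <= f v.

Lemma window_centred b t : 0 < b -> window F b t <= window F b 0.
Proof.
move=> b0; have [t0|t0] := leP 0 t; first exact: (window_centred_pos hinc hf).
have := @window_centred_pos _ _ _ (increment_bounds_reflect hf hinc) hf f_ge0
  b (- t) ltac:(lra) b0.
by rewrite !window_reflect opprK oppr0.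
Qed.

Lemma window_gap e b t : 0 < e -> e <= `|t| -> e <= b -> b <= 5 / 4 * e ->
  window F b t + e / 2 * (f (3 / 4 * e) - f e) <= window F b 0.
Proof.
move=> e0 et eb be; have [t0|t0] := leP 0 t.
  by rewrite ger0_norm // in et; exact: (window_gap_pos hinc hf f_ge0).
rewrite ltr0_norm // in et.
have := @window_gap_pos _ _ _ (increment_bounds_reflect hf hinc) hf f_ge0
  e b (- t) e0 et eb be.
by rewrite !window_reflect opprK oppr0.
Qed.

End WindowBothSides.

(** * A Chernoff bound *)

Section UnionBound.
Context d (T : measurableType d) (R : realType) (P : probability T R).

Lemma measurable_finite_union (I : finType) (D : pred I) (A : I -> set T) :
  (forall i, measurable (A i)) -> measurable (\bigcup_(i in [set i | D i]) A i).
Proof.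
by move=> mA; apply: fin_bigcup_measurable => //; exact: finite_finset.
Qed.

Lemma union_bound (I : finType) (D : pred I) (A : I -> set T) :
  (forall i, measurable (A i)) ->
  (P (\bigcup_(i in [set i | D i]) A i) <= \sum_(i | D i) P (A i))%E.
Proof.
move=> mA.
have -> : \bigcup_(i in [set i | D i]) A i =
    \big[setU/set0]_(i <- index_enum I | D i) A i.
  rewrite -bigcup_seq_cond (_ : [set i | D i] =
    [set i | (i \in index_enum I) && D i]) //.
  by apply/seteqP; split => i /=; rewrite mem_index_enum.
apply: (@proj2 (measurable (\big[setU/set0]_(i <- index_enum I | D i) A i))).
elim/big_rec2: _ => [|i s U Di [mU leU]]; first by rewrite measure0; split.
split; first exact: measurableU.
apply: le_trans (measureU2 _ (mA i) mU) _; exact: leeD.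
Qed.

End UnionBound.

Lemma expRN_le (R : realType) (l : R) : 0 <= l -> expR (- l) <= 1 - l + l ^+ 2.
Proof.
move=> l0; rewrite expRN -[leLHS]mul1r ler_pdivrMr ?expR_gt0 //.
apply: (@le_trans _ _ ((1 - l + l ^+ 2) * (1 + l))).
  have -> : (1 - l + l ^+ 2) * (1 + l) = 1 + l ^+ 3 by ring.
  by rewrite lerDl exprn_ge0.
rewrite ler_wpM2l ?expR_ge1Dx //; nra.
Qed.

Section Chernoff.
Context d (T : measurableType d) (R : realType) (P : probability T R).
Variables (I : finType) (X : I -> {RV P >-> R}) (B : I -> set R) (q : I -> R).
Hypotheses (indep : mutually_independent X) (mB : forall i, measurable (B i)).
Hypothesis hq : forall i, fine (P (X i @^-1` B i)) = q i.

Definition hits (J : {set I}) : set T :=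
  [set w | forall i, (if i \in J then B i else ~` B i) (X i w)].

Let mB' (J : {set I}) i : measurable (if i \in J then B i else ~` B i).
Proof. by case: ifP => _ //; exact: measurableC. Qed.

Lemma measurable_hits (J : {set I}) : measurable (hits J).
Proof.
have -> : hits J = \bigcap_(i in [set: I])
    (X i @^-1` (if i \in J then B i else ~` B i)).
  by apply/seteqP; split => [w h i _|w h i]; [exact: h|exact: (h i)].
apply: fin_bigcap_measurable => [|i _]; first exact: finite_finset.
exact: measurable_funPTI.
Qed.

Lemma probability_hits (J : {set I}) :
  P (hits J) = (\prod_i (if i \in J then q i else 1 - q i))%:E.
Proof.
rewrite -[LHS]fineK ?fin_num_measure //; last exact: measurable_hits.
congr EFin.
have := indep [set: I]%SET (mB' J).
have -> : [set w | forall i, i \in [set: I]%SET ->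
    (if i \in J then B i else ~` B i) (X i w)] = hits J.
  by apply/seteqP; split => w /= h i; [apply: h; rewrite inE|move=> _;
    apply: h].
move=> ->; rewrite (eq_bigl xpredT); last by move=> i; rewrite inE.
apply: eq_bigr => i _; case: ifP => _; first exact: hq.
rewrite preimage_setC probability_setC; last exact: measurable_funPTI.
by rewrite fineB ?fin_num_measure ?hq //; exact: measurable_funPTI.
Qed.

(** Only the 2 ^ #|I| events hits J matter, so the exponential moment of the
    number of hits is a finite sum, which factorizes over I.  The exponent
    l = e / 2 minimizes - l * e + l ^ 2. *)
Lemma chernoff (e : R) : 0 < e -> exists bad : set T,
  [/\ measurable bad,
      (P bad <= (expR (- (#|I|%:R * (e ^+ 2 / 4))))%:E)%E &
      forall w, ~ bad w ->
        \sum_i q i - #|I|%:R * e <= \sum_i \1_(B i) (X i w)].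
Proof.
move=> e0; set N := #|I|%:R; set S := \sum_i q i.
pose few (J : {set I}) := #|J|%:R < S - N * e.
exists (\bigcup_(J in [set J | few J]) hits J).
have q01 i : 0 <= q i <= 1.
  rewrite -hq -[X in _ <= _ <= X]/(fine 1%E).
  rewrite !fine_le ?fin_num_measure ?fine_ge0 //.
  - exact: measurable_funPTI.
  - by apply: probability_le1; exact: measurable_funPTI.
split.
- exact: measurable_finite_union measurable_hits.
- apply: le_trans (union_bound _ _ measurable_hits) _.
  under eq_bigr do rewrite probability_hits.
  rewrite sumEFin lee_fin.
  pose l := e / 2; have l0 : 0 <= l by rewrite /l; lra.
  pose W (J : {set I}) := \prod_i (if i \in J then q i else 1 - q i).
  have W0 J : 0 <= W J.
    by apply: prodr_ge0 => i _; have /andP[? ?] := q01 i; case: ifP; lra.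
  apply: (@le_trans _ _ (\sum_(J : {set I}) W J *
      expR (l * (S - N * e - #|J|%:R)))).
    rewrite [leRHS](bigID few) /= -[leLHS]addr0; apply: lerD; last first.
      by apply: sumr_ge0 => J _; rewrite mulr_ge0 ?expR_ge0.
    apply: ler_sum => J; rewrite /few => fJ.
    rewrite ler_peMr ?W0 //; apply: le_trans (expR_ge1Dx _).
    by rewrite lerDl mulr_ge0 // subr_ge0 ltW.
  have -> : \sum_(J : {set I}) W J * expR (l * (S - N * e - #|J|%:R)) =
      expR (l * (S - N * e)) * \prod_i (q i * expR (- l) + (1 - q i)).
    rewrite bigA_distr big_distrr; apply: eq_bigr => J _ /=.
    rewrite mulrBr expRD mulrCA; congr (_ * _).
    have -> : expR (- (l * #|J|%:R)) =
        \prod_i (if i \in J then expR (- l) else 1).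
      by rewrite -big_mkcond prodr_const -expRM_natr mulNr.
    rewrite -big_split; apply: eq_bigr => i _ /=.
    by case: ifP; rewrite ?mulr1.
  apply: (@le_trans _ _ (expR (l * (S - N * e)) *
      expR (\sum_i q i * (- l + l ^+ 2)))).
    rewrite ler_pM2l ?expR_gt0 // expR_sum; apply: ler_prod => i _.
    have /andP[q0 q1] := q01 i; have El := expRN_le l0.
    have Ep := expR_gt0 (- l).
    apply/andP; split; first by apply: addr_ge0;
      [rewrite mulr_ge0 // ltW|rewrite subr_ge0].
    apply: le_trans (expR_ge1Dx _).
    have : q i * expR (- l) <= q i * (1 - l + l ^+ 2) by rewrite ler_wpM2l.
    lra.
  rewrite -expRD ler_expR -mulr_suml -/S.
  have SN : S <= N.
    rewrite /S /N -sum1_card natr_sum; apply: ler_sum => i _.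
    by have /andP[] := q01 i.
  have : S * l ^+ 2 <= N * l ^+ 2 by rewrite ler_wpM2r // sqr_ge0.
  rewrite /l; lra.
- move=> w hw; rewrite leNgt; apply/negP => lt.
  apply: hw; exists [set i | X i w \in B i]%SET => /=.
    rewrite /few; apply: le_lt_trans lt.
    rewrite -sum1_card natr_sum big_mkcond; apply: ler_sum => i _.
    by rewrite inE indicE; case: (_ \in _).
  move=> i; rewrite inE; case: ifP => [/set_mem//|/negbT].
  by rewrite notin_setE.
Qed.

End Chernoff.

(** * The uniform law of large numbers *)

(** Q n is only required to contain the complement of a small measurable set,
    because it may quantify over uncountably many parameters. *)
Definition whp d (T : measurableType d) (R : realType) (P : probability T R)
    (Q : nat -> set T) : Prop :=
  exists2 bad : nat -> set T,
    (forall n, measurable (bad n)) /\ P (bad n) @[n --> \oo] --> 0%E &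
    forall n w, ~ bad n w -> Q n w.

Lemma measurable_superlevel d (T : measurableType d) (R : realType)
    (h : T -> R) (e : R) :
  measurable_fun setT h -> measurable [set w | e < h w].
Proof.
move=> mh; have := mh measurableT _ (@measurable_itv R `]e, +oo[).
rewrite setTI; congr (measurable _).
by apply/seteqP; split => w /=; rewrite in_itv /= andbT.
Qed.

Section Whp.
Context d (T : measurableType d) (R : realType) (P : probability T R).
Implicit Types (Q : nat -> set T).

Lemma whp_sub Q Q' : (forall n, Q n `<=` Q' n) -> whp P Q -> whp P Q'.
Proof. by move=> h [bad hb hQ]; exists bad => // n w /hQ /h. Qed.

Lemma whpI Q Q' : whp P Q -> whp P Q' -> whp P (fun n => Q n `&` Q' n).
Proof.
move=> [bad [mb cb] hQ] [bad' [mb' cb'] hQ'].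
exists (fun n => bad n `|` bad' n); last first.
  by move=> n w /not_orP[? ?]; split; [exact: hQ|exact: hQ'].
split=> [n|]; first exact: measurableU.
apply: (@squeeze_cvge _ _ _ _ (fun=> 0%E) _ (fun n =>
  P (bad n) + P (bad' n))%E).
- by apply: nearW => n; rewrite measure_ge0 measureU2.
- exact: cvg_cst.
- by rewrite -[0%E]adde0; apply: cvgeD.
Qed.

Lemma whp_forall (m : nat) (Q : 'I_m -> nat -> set T) :
  (forall k, whp P (Q k)) -> whp P (fun n => [set w | forall k, Q k n w]).
Proof.
elim: m Q => [|m IH] Q hQ.
  exists (fun=> set0); last by move=> n w _ [].
  by split => //; under eq_fun do rewrite measure0; exact: cvg_cst.
have /whpI/(_ (hQ ord_max)) := IH (fun k =>
  Q (widen_ord (leqnSn m) k)) (fun k => hQ _).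
apply: whp_sub => n w [h1 h2] k; have [km|km] := ltnP k m.
  have -> : k = widen_ord (leqnSn m) (Ordinal km) by exact: val_inj.
  exact: h1.
by have -> : k = ord_max by apply/val_inj/eqP; rewrite eqn_leq km -ltnS ltn_ord.
Qed.

Lemma whp_cvg_in_probability (Z : nat -> {RV P >-> R}) (l e : R) :
  cvg_in_probability P (fun n => Z n : T -> R) l -> 0 < e ->
  whp P (fun n => [set w | `|Z n w - l| <= e]).
Proof.
move=> hZ e0; exists (fun n => [set w | e < `|Z n w - l|]).
  split=> [n|]; last exact: hZ.
  apply: (@measurable_superlevel _ _ _ (fun w => `|Z n w - l|) e).
  by apply: measurableT_comp => //; apply: measurable_funB.
by move=> n w /negP; rewrite -leNgt.
Qed.

Lemma cvg0_of_whp (Q A : nat -> set T) : whp P Q ->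
  (forall n, measurable (A n)) ->
  (\forall n \near \oo, Q n `<=` ~` A n) -> P (A n) @[n --> \oo] --> 0%E.
Proof.
move=> [bad [mb cb] hQ] mA hA.
apply: (@squeeze_cvge _ _ _ _ (fun=> 0%E) _ (fun n => P (bad n))).
- near=> n; rewrite measure_ge0 /=; apply: le_measure; rewrite ?inE //.
  move=> w Aw; apply: contrapT => /hQ.
  have hn : Q n `<=` ~` A n by near: n.
  by move=> /hn; exact.
- exact: cvg_cst.
- exact: cb.
Unshelve. all: by end_near.
Qed.

Lemma exp_bound_cvg0 (A : nat -> set T) (c : R) : 0 < c ->
  (forall n, measurable (A n)) ->
  (\forall n \near \oo, P (A n) <= (expR (- (n%:R * c)))%:E)%E ->
  P (A n) @[n --> \oo] --> 0%E.
Proof.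
move=> c0 mA hA.
apply: (@squeeze_cvge _ _ _ _ (fun=> 0%E) _ (fun n => (expR (- c) ^+ n)%:E)).
- near=> n; rewrite measure_ge0 /= -expRM_natl mulrN; near: n; exact: hA.
- exact: cvg_cst.
- apply: cvg_EFin; first exact: nearW.
  apply: cvg_expr; rewrite ger0_norm ?expR_ge0 //.
  by rewrite -expR0 ltr_expR oppr_lt0.
Unshelve. all: by end_near.
Qed.

End Whp.

Lemma near_dimension_le (R : realType) (p : nat -> nat) (a c : R) :
  (p n)%:R / n%:R @[n --> \oo] --> (0 : R) -> 0 <= a -> 0 < c ->
  \forall n \near \oo, (p n).+1%:R * a <= n%:R * c.
Proof.
move=> hp a0 c0.
have a1 : 0 < a + 1 by lra.
have e0 : 0 < c / (2 * (a + 1)) by rewrite divr_gt0 //; lra.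
have h1 : \forall n \near \oo, (p n)%:R / n%:R < c / (2 * (a + 1)).
  exact: (cvgr_lt _ hp).
have h2 : \forall n \near \oo, 2 * a / c < n%:R.
  exact: nbhs_infty_gtr.
near=> n.
have n0 : 0 < n%:R :> R.
  by apply: (@le_lt_trans _ _ (2 * a / c));
    [rewrite divr_ge0 ?mulr_ge0 ?(ltW c0)|near: n].
have : (p n)%:R / n%:R < c / (2 * (a + 1)) by near: n.
rewrite ltr_pdivrMr //.
have : 2 * a / c < n%:R by near: n.
rewrite ltr_pdivrMr // -natr1.
have : c = c / (2 * (a + 1)) * (2 * (a + 1)) by rewrite divfK //; lra.
move: e0; set D := c / _ => e0 cE h2' h1'.
have h3 : (p n)%:R * a <= D * n%:R * a by rewrite ler_wpM2r // ltW.
have h4 : 0 <= D * n%:R by rewrite mulr_ge0 // ltW.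
have h5 : n%:R * c = 2 * (D * n%:R * a) + 2 * (D * n%:R) by rewrite {1}cE; ring.
lra.
Unshelve. all: by end_near.
Qed.

(** The grid points cut the line into K + 1 cells; counting the points below t
    numbers them in increasing order. *)
Definition cell (R : realType) (K : nat) (tau : nat -> R) (t : R) : nat :=
  (\sum_(k < K) (tau k <= t)%R)%N.

(** The cells of all the x_i . b are determined by the sign pattern of the
    n * K forms x_i . b - tau_k.  For large n there are at most exp (n e^2 / 8)
    patterns, and each fails with probability at most exp (- n e^2 / 4). *)
Lemma uniform_law d (T : measurableType d) (R : realType) (P : probability T R)
    (p : nat -> nat) (x : forall n, 'I_n -> 'cV[R]_(p n))
    (u : forall n, 'I_n -> {RV P >-> R})
    (K : nat) (tau : nat -> R) (E : nat -> set R) (q : nat -> R) (e : R) :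
  (forall n, mutually_independent (u n)) ->
  (p n)%:R / n%:R @[n --> \oo] --> (0 : R) ->
  (forall j, measurable (E j)) ->
  (forall n i j, fine (P (u n i @^-1` E j)) = q j) ->
  0 < e ->
  whp P (fun n => [set w | forall b : 'cV[R]_(p n),
    \sum_(i < n) q (cell K tau (dotv (x n i) b)) - n%:R * e <=
    \sum_(i < n) \1_(E (cell K tau (dotv (x n i) b))) (u n i w)]).
Proof.
move=> indep hpn mE hq e0.
pose pattern n b := [set j : 'I_n * 'I_K | tau j.2 <= dotv (x n j.1) b]%SET.
pose patterns n := [set A | `[< exists b, A = pattern n b >]]%SET.
pose acell n (A : {set 'I_n * 'I_K}) i : nat := (\sum_(k < K) ((i, k) \in A))%N.
have acellE n b i : acell n (pattern n b) i = cell K tau (dotv (x n i) b).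
  by apply: eq_bigr => k _; rewrite inE.
have hbad n (A : {set 'I_n * 'I_K}) := chernoff (indep n)
  (fun i => mE (acell n A i)) (fun i => hq n i (acell n A i)) e0.
have [bad hB] : exists bad : forall n, {set 'I_n * 'I_K} -> set T, forall n A,
   [/\ measurable (bad n A),
      (P (bad n A) <= (expR (- (n%:R * (e ^+ 2 / 4))))%:E)%E &
      forall w, ~ bad n A w ->
        \sum_i q (acell n A i) - n%:R * e <=
          \sum_i \1_(E (acell n A i)) (u n i w)].
  exists (fun n A => projT1 (cid (hbad n A))) => n A.
  by case: cid => B /=; rewrite card_ord.
have mbad n A : measurable (bad n A) by have [] := hB n A.
exists (fun n => \bigcup_(A in [set A | A \in patterns n]) bad n A); last first.
  move=> n w hw b; have [_ _] := hB n (pattern n b).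
  move=> /(_ w); under eq_bigr do rewrite acellE.
  under [in X in _ <= X]eq_bigr do rewrite acellE.
  apply => hwb; apply: hw; exists (pattern n b) => //=.
  by rewrite inE; apply/asboolP; exists b.
have mBad n : measurable (\bigcup_(A in [set A | A \in patterns n]) bad n A).
  exact: (@measurable_finite_union _ _ _ [in patterns n]).
split=> //; apply: (@exp_bound_cvg0 _ _ _ _ _ (e ^+ 2 / 8)) => //.
  by rewrite divr_gt0 // exprn_gt0.
pose lam : R := Num.min 1 (e ^+ 2 / (16 * K.+1%:R)).
have K0 : 0 < K.+1%:R :> R by rewrite ltr0n.
have e2 : 0 < e ^+ 2 by rewrite exprn_gt0.
have l0 : 0 < lam by rewrite lt_min ltr01 divr_gt0 // mulr_gt0.
have l1 : lam <= 1 by rewrite ge_min lexx.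
have lK : lam * K%:R <= e ^+ 2 / 16.
  apply: (@le_trans _ _ (lam * K.+1%:R));
    first by rewrite ler_wpM2l ?ler_nat // ltW.
  rewrite -ler_pdivlMr //; rewrite ge_min; apply/orP; right.
  by rewrite invfM mulrA.
have ll : 0 <= ln lam^-1.
  by rewrite ln_ge0 // invf_ge1.
have e16 : 0 < e ^+ 2 / 16 by rewrite divr_gt0.
have := near_dimension_le hpn ll e16; apply: filterS => n hn.
apply: (le_trans (union_bound _ _ (mbad n))).
apply: (@le_trans _ _ (\sum_(A in patterns n) (expR (- (n%:R * (e ^+ 2 /
  4))))%:E)%E).
  by apply: lee_sum => A _; have [] := hB n A.
rewrite sumEFin lee_fin sumr_const -[leLHS]mulr_natl.
have hF A : A \in patterns n ->
    exists b, A = pattern n b.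
  by rewrite inE => /asboolP.
have := @card_halfspace_patterns R (p n) _ (fun j : 'I_n * 'I_K => x n j.1)
  (fun j : 'I_n * 'I_K => tau j.2) (patterns n) lam hF l0 l1.
rewrite card_prod !card_ord natrM => hc.
apply: le_trans (ler_wpM2r (expR_ge0 _) hc) _.
rewrite -expRD ler_expR.
have : lam * (n%:R * K%:R) <= n%:R * (e ^+ 2 / 16).
  by rewrite mulrCA ler_wpM2l.
lra.
Qed.

(** * Exceedance counts *)

Lemma cell_le (R : realType) K (tau : nat -> R) t : (cell K tau t <= K)%N.
Proof.
rewrite -[leqRHS]card_ord -sum1_card; apply: leq_sum => k _.
by case: (_ <= _)%R.
Qed.

Lemma lt_cell (R : realType) K (tau : nat -> R) t k :
  {homo tau : i j / (i <= j)%N >-> i <= j} -> (k < K)%N ->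
  (k < cell K tau t)%N = (tau k <= t).
Proof.
move=> htau; elim: K k => // K IH k; rewrite ltnS => kK.
rewrite /cell big_ord_recr /=; have [Kt|Kt] := leP (tau K) t.
  rewrite (eq_bigr (fun=> 1%N)) => [|i _]; last first.
    by rewrite (le_trans _ Kt) // htau // ltnW.
  by rewrite sum1_card card_ord addn1 ltnS kK (le_trans _ Kt) // htau.
rewrite addn0; move: kK; rewrite leq_eqVlt => /orP[/eqP->|/IH//].
by rewrite leNgt Kt /=; apply/negbTE; rewrite -leqNgt cell_le.
Qed.

Section Law.
Context d (T : measurableType d) (R : realType) (P : probability T R).
Variables (F : R -> R) (X : {RV P >-> R}).
Hypothesis hX : forall r, cdf X r = (F r)%:E.

Lemma law_le a : P (X @^-1` `]-oo, a]) = (F a)%:E.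
Proof. by rewrite -hX. Qed.

Lemma law_gt a : P (X @^-1` `]a, +oo[) = (1 - F a)%:E.
Proof. by rewrite EFinB -hX -ccdf_1_cdf. Qed.

Lemma law_itv a b : a <= b -> P (X @^-1` `]a, b]) = (F b - F a)%:E.
Proof.
move=> ab; have : P (X @^-1` `]-oo, b]) = (P (X @^-1` `]-oo, a]) +
  P (X @^-1` `]a, b]))%E.
  rewrite -measureU //; try exact: measurable_funPTI.
    congr (P _); rewrite -preimage_setU; congr (_ @^-1` _).
    by rewrite -itv_bndbnd_setU // bnd_simp.
  rewrite -preimage_setI; apply/seteqP; split => w //=.
  by rewrite !in_itv /= => -[wa /andP[]]; rewrite ltNge wa.
rewrite !law_le; case: (P _) => [r|//|//].
by rewrite -EFinD => -[->]; congr EFin; ring.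
Qed.

Lemma law_tails e : 0 < e -> exists M, forall r, M <= r ->
  F (- r) <= e /\ 1 - e <= F r.
Proof.
move=> e0.
have FE : F = fine \o cdf X by apply/funext => r /=; rewrite hX.
have c1 : F r @[r --> +oo] --> (1 : R) by rewrite FE;
  exact: (fine_cvg (cvg_cdfy1 X)).
have c0 : F r @[r --> -oo] --> (0 : R) by rewrite FE;
  exact: (fine_cvg (cvg_cdfNy0 X)).
have [M [_ hM]] := cvgr_ge _ c1 (1 - e) ltac:(lra).
have [N [_ hN]] := cvgr_le _ c0 e e0.
exists (Num.max M (- N) + 1) => r hr; split.
  apply: hN; suff : - N <= Num.max M (- N) by lra.
  by rewrite le_max lexx orbT.
apply: hM; suff : M <= Num.max M (- N) by lra.
by rewrite le_max lexx.
Qed.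

End Law.

Section Brackets.
Context d (T : measurableType d) (R : realType) (P : probability T R).
Variables (F f : R -> R) (X0 : {RV P >-> R}).
Hypotheses (hinc : increment_bounds F f) (hf : even_unimodal f).
Hypothesis f_ge0 : forall v, 0 <= f v.
Hypothesis hX0 : forall r, cdf X0 r = (F r)%:E.

Let F_mono l r : l <= r -> F l <= F r.
Proof. by move=> /(increments_ge0 hinc hf f_ge0); rewrite subr_ge0. Qed.

Let F01 r : 0 <= F r <= 1.
Proof. by rewrite -!lee_fin -hX0 cdf_ge0 cdf_le1. Qed.

(** For t in a cell [l, r], the event {v <= l - b} or {r + b < v} lies in
    {b <= |v - t|}.  Its probability is smaller by at most f 0 times the
    length of the cell; in the two unbounded cells, the half of the event that
    is dropped is a tail of F. *)
Lemma brackets (b e : R) : 0 < b -> 0 < e ->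
  exists K, exists tau : nat -> R, exists E : nat -> set R, exists q : nat -> R,
  [/\ forall j, measurable (E j),
      forall X : {RV P >-> R}, (forall r, cdf X r = (F r)%:E) ->
        forall j, fine (P (X @^-1` E j)) = q j,
      forall t v, E (cell K tau t) v -> b <= `|v - t| &
      forall t, 1 - window F b t - e <= q (cell K tau t)].
Proof.
move=> b0 e0.
have [M0 hM0] := law_tails hX0 (ltac:(lra) : 0 < e / 2).
pose M := Num.max M0 0 + b.
have M0M : M0 <= M - b by rewrite /M addrK le_max lexx.
have Mb : 0 <= M - b by rewrite /M addrK le_max lexx orbT.
have f00 := f_ge0 0.
pose h := e / (2 * (f 0 + 1)).
have h0 : 0 < h by rewrite divr_gt0 //; lra.
have fh : f 0 * h <= e / 2.
  have -> : e / 2 = (f 0 + 1) * h by rewrite /h; field; lra.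
  by rewrite ler_pM2r //; lra.
pose N := (Num.truncn (2 * M / h)).+1.
have Nh : 2 * M <= N%:R * h.
  by rewrite -ler_pdivrMr // ltW // truncnS_gt.
pose tau k : R := - M + k%:R * h.
have htau : {homo tau : i j / (i <= j)%N >-> i <= j}.
  by move=> i j ij; rewrite /tau lerD2l ler_pM2r // ler_nat.
pose A j := if (0 < j)%N then `]-oo, tau j.-1 - b]%classic else set0.
pose B j := if (j <= N)%N then `]tau j + b, +oo[%classic else set0.
have AB j : A j `&` B j = set0.
  rewrite /A /B; case: ifP => _; rewrite ?set0I //; case: ifP => _;
    rewrite ?setI0 //.
  apply/seteqP; split => v //=; rewrite !in_itv /= andbT => -[v1 v2].
  have := htau j.-1 j (leq_pred j); lra.
exists N.+1, tau, (fun j => A j `|` B j), (fun j =>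
  (if (0 < j)%N then F (tau j.-1 - b) else 0) +
  (if (j <= N)%N then 1 - F (tau j + b) else 0)).
have mA j : measurable (A j) by rewrite /A; case: ifP => _ //;
  exact: measurable_itv.
have mB j : measurable (B j) by rewrite /B; case: ifP => _ //;
  exact: measurable_itv.
have hlo t : (0 < cell N.+1 tau t)%N -> tau (cell N.+1 tau t).-1 <= t.
  move=> j0; rewrite -(lt_cell (K := N.+1)) // ?prednK //.
  exact: leq_trans (cell_le _ _ _).
have hhi t : (cell N.+1 tau t <= N)%N -> t < tau (cell N.+1 tau t).
  by move=> jN; rewrite ltNge -(lt_cell (K := N.+1)) // ltnn.
split.
- by move=> j; exact: measurableU.
- move=> X hX j.
  have -> : P (X @^-1` (A j `|` B j)) = (P (X @^-1` A j) + P (X @^-1` B j))%E.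
    rewrite preimage_setU measureU //.
    + by apply: measurable_funPTI.
    + by apply: measurable_funPTI.
    + by rewrite -preimage_setI AB preimage_set0.
  have -> : P (X @^-1` A j) = (if (0 < j)%N then F (tau j.-1 - b) else 0)%:E.
    by rewrite /A; case: ifP => _;
      rewrite ?preimage_set0 ?measure0 // (law_le hX).
  have -> // : P (X @^-1` B j) =
    (if (j <= N)%N then 1 - F (tau j + b) else 0)%:E.
  by rewrite /B; case: ifP => _;
    rewrite ?preimage_set0 ?measure0 // (law_gt hX).
- move=> t v []; rewrite /A /B; case: ifP => // hj;
  rewrite /= in_itv /= ?andbT => hv.
  + by have := hlo _ hj; rewrite ler_normr; move=> ht; apply/orP; right; lra.
  + by have := hhi _ hj; rewrite ler_normr; move=> ht; apply/orP; left; lra.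
- move=> t; have := hlo t; have := hhi t; have := cell_le N.+1 tau t.
  set j := cell _ _ _ => jK hi lo.
  have [FM1 FM2] := hM0 M ltac:(lra); have [FMb1 FMb2] := hM0 (M - b) M0M.
  have tauS : (0 < j)%N -> tau j = tau j.-1 + h.
    by move=> j0; rewrite -{1}(prednK j0) /tau -natr1; ring.
  have /andP[F0tb F1tb] := F01 (t - b); have /andP[F0tb' F1tb'] := F01 (t + b).
  suff : F (t - b) - e / 2 <= (if (0 < j)%N then F (tau j.-1 - b) else 0) /\
         1 - F (t + b) - e / 2 <= (if (j <= N)%N then 1 - F (tau j + b) else 0).
    by rewrite /window => -[]; lra.
  split; case: ifP => hj.
  + have t1 := lo hj; have [jN|jN] := leqP j N.
      have t2 := hi jN; rewrite tauS // in t2.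
      have := increments_le hinc hf f_ge0 (ltac:(lra) : tau j.-1 - b <= t - b).
      have : f 0 * (t - b - (tau j.-1 - b)) <= f 0 * h
        by rewrite ler_wpM2l //; lra.
      lra.
    have jE : j.-1 = N by apply/eqP; rewrite -eqSS prednK // eqn_leq jK.
    have := @F_mono (M - b) (tau j.-1 - b); rewrite jE {1}/tau.
    move=> /(_ ltac:(lra)); lra.
  + have : t < tau j by apply: hi; rewrite leqNgt; move: hj; case: (j).
    have -> : j = 0%N by move/negbT: hj; rewrite -eqn0Ngt => /eqP.
    rewrite /tau mul0r addr0 => tM.
    have := @F_mono (t - b) (- M) ltac:(lra); lra.
  + have t2 := hi hj; have [j0|j0] := ltnP 0 j.
      have t1 := lo j0; have := tauS j0 => tj.
      have := increments_le hinc hf f_ge0 (ltac:(lra) : t + b <= tau j + b).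
      have : f 0 * (tau j + b - (t + b)) <= f 0 * h by rewrite ler_wpM2l //;
        lra.
      lra.
    have -> : j = 0%N by apply/eqP; rewrite -leqn0.
    have -> : tau 0%N + b = - (M - b) by rewrite /tau; ring.
    lra.
  + have jE : j = N.+1 by apply/eqP; rewrite eqn_leq jK ltnNge hj.
    have := lo ltac:(by rewrite jE); rewrite jE /= {1}/tau => tN.
    have := @F_mono M (t + b) ltac:(lra); lra.
Qed.

End Brackets.

Section LevelLaws.
Context d (T : measurableType d) (R : realType) (P : probability T R).
Variables (F f : R -> R).
Hypotheses (hinc : increment_bounds F f) (hf : even_unimodal f).
Hypothesis f_ge0 : forall v, 0 <= f v.

Lemma lower_law (p : nat -> nat) (x : forall n, 'I_n -> 'cV[R]_(p n))
    (u : forall n, 'I_n -> {RV P >-> R}) (b e : R) :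
  (forall n, iid (u n) F) ->
  (p n)%:R / n%:R @[n --> \oo] --> (0 : R) -> 0 < b -> 0 < e ->
  whp P (fun n => [set w | forall t : 'cV[R]_(p n),
    \sum_(i < n) (1 - window F b (dotv (x n i) t)) - n%:R * e <=
    \sum_(i < n) (b <= `|u n i w - dotv (x n i) t|)%R%:R]).
Proof.
move=> hu hpn b0 e0; have e2 : 0 < e / 2 by lra.
have law n i r : cdf (u n i) r = (F r)%:E by have [_] := hu n; apply.
have [K [tau [E [q [mE hq hE hw]]]]] :=
  brackets hinc hf f_ge0 (law 1%N ord0) b0 e2.
have := @uniform_law _ _ _ _ _ x u K tau E q _ (fun n => (hu n).1) hpn mE
  (fun n i j => hq (u n i) (law n i) j) e2.
apply: whp_sub => n w h t; apply: le_trans (le_trans (h t) _); last first.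
  apply: ler_sum => i _; rewrite indicE; case: (boolP (_ \in _)) => [|_].
    by move=> /set_mem /hE ->.
  exact: ler0n.
have : \sum_(i < n) (1 - window F b (dotv (x n i) t) - e / 2) <=
  \sum_(i < n) q (cell K tau (dotv (x n i) t)) by apply: ler_sum => i _;
    exact: hw.
rewrite big_split /= sumr_const card_ord -[in - (e / 2) *+ n]mulr_natl; lra.
Qed.

(** Exceedances are bounded above by counting the errors in ]- b, b - h] from
    below, which needs no parameter: the law is applied with an empty grid. *)
Lemma upper_law (u : forall n, 'I_n -> {RV P >-> R}) (b e : R) :
  (forall n, iid (u n) F) -> 0 < b -> 0 < e ->
  whp P (fun n => [set w |
    \sum_(i < n) (b <= `|u n i w|)%R%:R <=
      n%:R * (1 - window F b 0) + n%:R * e]).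
Proof.
move=> hu b0 e0; have e2 : 0 < e / 2 by lra.
have law n i r : cdf (u n i) r = (F r)%:E by have [_] := hu n; apply.
have f00 := f_ge0 0.
pose h := Num.min b (e / (2 * (f 0 + 1))).
have h0 : 0 < h by rewrite lt_min b0 divr_gt0 //; lra.
have hb : h <= b by rewrite ge_min lexx.
have fh : f 0 * h <= e / 2.
  apply: (@le_trans _ _ ((f 0 + 1) * (e / (2 * (f 0 + 1))))).
    by apply: ler_pM; [|exact: ltW|lra|rewrite ge_min lexx orbT].
  by rewrite le_eqVlt; apply/orP; left; apply/eqP; field; lra.
have hq n i (j : nat) : fine (P (u n i @^-1` `]-b, b - h]%classic)) =
    F (b - h) - F (- b).
  by rewrite (law_itv (law n i)) //; lra.
have p0 : 0%:R / n%:R @[n --> \oo] --> (0 : R).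
  by under eq_fun do rewrite mul0r; exact: cvg_cst.
have := @uniform_law _ _ _ _ (fun=> 0%N) (fun _ _ => 0) u 0 (fun=> 0)
  (fun=> `]-b, b - h]%classic) (fun=> F (b - h) - F (- b)) _
  (fun n => (hu n).1) p0 (fun=> measurable_itv _) hq e2.
apply: whp_sub => n w /(_ 0) h1 /=.
have h2 : \sum_(i < n) (b <= `|u n i w|)%R%:R +
    \sum_(i < n) \1_(`]-b, b - h]%classic) (u n i w) <= n%:R :> R.
  rewrite -big_split /= -[n in leRHS]card_ord -sum1_card natr_sum;
    apply: ler_sum => i _.
  rewrite indicE; case: (boolP (_ \in _)) => [/set_mem/=|_];
    last by rewrite addr0 ler_nat leq_b1.
  rewrite in_itv /= => hv;
    have /lt_geF -> : `|u n i w| < b by rewrite ltr_norml; lra.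
  by rewrite add0r.
move: h1; rewrite sumr_const card_ord -[_ *+ n]mulr_natl /window add0r sub0r.
have := increments_le hinc hf f_ge0 (ltac:(lra) : b - h <= b).
have -> : b - (b - h) = h by ring.
move=> h3 h1.
have : n%:R * (F b - F (- b) - e / 2) <= n%:R * (F (b - h) - F (- b)).
  by rewrite ler_wpM2l //; lra.
lra.
Qed.

End LevelLaws.

(** * The constant eta_n *)

Section Eta.
Variables (R : realType) (n p : nat) (x : 'I_n -> 'cV[R]_p).

Lemma dotvZ (a b : 'cV[R]_p) c : dotv a (c *: b) = c * dotv a b.
Proof. by rewrite /dotv -scalemxAr mxE. Qed.

Lemma dotvB (a b c : 'cV[R]_p) : dotv a (b - c) = dotv a b - dotv a c.
Proof. by rewrite /dotv mulmxBr !mxE. Qed.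

Lemma enormZ (b : 'cV[R]_p) c : enorm (c *: b) = `|c| * enorm b.
Proof.
rewrite /enorm -sqrtr_sqr -sqrtrM ?sqr_ge0 // mulr_sumr; congr Num.sqrt.
by apply: eq_bigr => j _; rewrite mxE exprMn.
Qed.

Lemma inf_ge0 (A : set R) : (forall r, A r -> 0 <= r) -> 0 <= inf A.
Proof.
move=> h; have [->|A0] := eqVneq A set0; first by rewrite inf0.
by apply: lb_le_inf => //; exact/set0P.
Qed.

Let maxdot (A : {set 'I_n}) (t : 'cV[R]_p) :=
  \big[Num.max/0]_(i in A) `|dotv (x i) t|.
Let inner (A : {set 'I_n}) := [set maxdot A t | t in [set t | enorm t = 1]].

Let inner_ge0 A r : inner A r -> 0 <= r.
Proof. by move=> [t _ <-]; exact: bigmax_ge_id. Qed.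

Lemma eta_n_ge0 alpha : 0 <= eta_n x alpha.
Proof.
by apply: inf_ge0 => r [A _ <-]; apply: inf_ge0 => s; exact: inner_ge0.
Qed.

(** Otherwise [n * alpha] of the design points would satisfy |x_i . v| < e, and
    this set of indices with the direction v / ||v|| shows that
    eta_n <= e / ||v||. *)
Lemma eta_n_large (alpha e : R) (v : 'cV[R]_p) :
  0 <= alpha -> 0 < e -> e < eta_n x alpha * enorm v ->
  n%:R * (1 - alpha) <= \sum_(i < n) (e <= `|dotv (x i) v|)%R%:R.
Proof.
move=> a0 e0 ev; set r := enorm v.
have r0 : 0 < r.
  rewrite lt_neqAle sqrtr_ge0 andbT; apply/eqP => r0.
  by move: ev; rewrite -/r -r0 mulr0; lra.
pose C := [set i | `|dotv (x i) v| < e]%SET.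
have na0 : 0 <= n%:R * alpha by rewrite mulr_ge0.
have : (#|C| < Num.truncn (n%:R * alpha))%N.
  rewrite ltnNge; apply/negP => hC.
  have [A [AC cA]] : exists A : {set 'I_n},
      A \subset C /\ #|A| = Num.truncn (n%:R * alpha).
    exists [set:: take (Num.truncn (n%:R * alpha)) (enum C)]%SET; split.
      by apply/fintype.subsetP => i; rewrite inE => /mem_take; rewrite mem_enum.
    rewrite cardsE; move/card_uniqP: (take_uniq (Num.truncn (n%:R * alpha))
      (enum_uniq C)) => ->.
    by rewrite size_takel // -cardE.
  have hA : maxdot A (r^-1 *: v) <= e / r.
    apply: bigmax_le => [|i /(fintype.subsetP AC)];
      first by rewrite divr_ge0 // ltW.
    rewrite inE => /ltW h;
      rewrite dotvZ normrM ger0_norm ?invr_ge0 ?(ltW r0) //.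
    by rewrite mulrC ler_pM2r ?invr_gt0.
  have h1 : inf (inner A) <= e / r.
    apply: le_trans hA; apply: ge_inf; first by exists 0 => s; exact: inner_ge0.
    exists (r^-1 *: v) => //=; rewrite enormZ ger0_norm ?invr_ge0 ?(ltW r0) //.
    by rewrite mulVf // gt_eqF.
  have h2 : eta_n x alpha <= e / r.
    apply: le_trans h1; apply: ge_inf; last by exists A.
    by exists 0 => s [A' _ <-]; apply: inf_ge0 => s'; exact: inner_ge0.
  by move: ev; rewrite ltNge -ler_pdivlMr // h2.
move=> /ltnW; rewrite truncn_ge_nat // => hC.
have : \sum_(i < n) (e <= `|dotv (x i) v|)%R%:R + #|C|%:R = n%:R :> R.
  rewrite -sum1_card natr_sum [X in _ + X]big_mkcond -big_split /=.
  rewrite (eq_bigr (fun=> 1)) ?sumr_const ?card_ord // => i _.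
  by rewrite inE; case: leP => _; rewrite ?addr0 ?add0r.
lra.
Qed.

End Eta.

Lemma measurable_enorm d (T : measurableType d) (R : realType) (p : nat)
    (b : T -> 'cV[R]_p) (c : 'cV[R]_p) :
  random_vector b -> measurable_fun setT (fun w => enorm (b w - c)).
Proof.
move=> hb; rewrite /enorm.
apply: (@measurableT_comp _ _ _ _ _ _ (@Num.sqrt R)).
  by apply: continuous_measurable_fun; exact: sqrt_continuous.
apply: measurable_sum => j; apply: measurable_funX.
under eq_fun do rewrite !mxE; exact: measurable_funB.
Qed.

(** * Comparing the objective at the estimator and at the true parameter *)

Section Levels.
Variables (R : realType) (rho : R -> R) (m : nat) (a : 'I_m -> R).
Hypothesis cake : forall v, \sum_(k < m) (a k <= `|v|)%R%:R <= m.+1%:R * rho v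
                            <= \sum_(k < m) (a k <= `|v|)%R%:R + 1.

(** The loss of one level per index is the term n. *)
Lemma exceedances_of_objective (n : nat) (s : R) (u t : 'I_n -> R) : 0 < s ->
  \sum_(i < n) rho ((u i - t i) / s) <= \sum_(i < n) rho (u i / s) ->
  \sum_(k < m) \sum_(i < n) (s * a k <= `|u i - t i|)%R%:R <=
  \sum_(k < m) \sum_(i < n) (s * a k <= `|u i|)%R%:R + n%:R :> R.
Proof.
move=> s0 h.
have scale v k : (s * a k <= `|v|) = (a k <= `|v / s|).
  by rewrite normrM [`|s^-1|]ger0_norm ?invr_ge0 ?(ltW s0) // ler_pdivlMr //
    mulrC.
rewrite exchange_big [in leRHS]exchange_big /=.
under eq_bigr do under eq_bigr do rewrite scale.
under [in leRHS]eq_bigr do under eq_bigr do rewrite scale.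
apply: (@le_trans _ _ (\sum_(i < n) m.+1%:R * rho ((u i - t i) / s))).
  by apply: ler_sum => i _; have /andP[] := cake ((u i - t i) / s).
apply: (@le_trans _ _ (\sum_(i < n) m.+1%:R * rho (u i / s))).
  by rewrite -!mulr_sumr ler_pM2l ?ltr0n.
have -> : n%:R = \sum_(i < n) 1 :> R by rewrite sumr_const card_ord.
by rewrite -big_split; apply: ler_sum => i _; have /andP[] := cake (u i / s).
Qed.

(** How strict monotonicity of rho on [v1, v2] turns into a proportion of the
    thresholds. *)
Lemma levels_between (v1 v2 : R) : 0 <= v1 -> v1 <= v2 ->
  m.+1%:R * (rho v2 - rho v1) - 1 <= \sum_(k < m) (v1 <= a k <= v2)%R%:R.
Proof.
move=> v10 v12.
have /andP[_ h2] := cake v2; have /andP[h1 _] := cake v1.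
rewrite ger0_norm in h1 => //; rewrite ger0_norm in h2;
  last exact: le_trans v12.
suff : \sum_(k < m) (a k <= v2)%R%:R <=
    \sum_(k < m) (v1 <= a k <= v2)%R%:R + \sum_(k < m) (a k <= v1)%R%:R :> R
      by lra.
rewrite -big_split; apply: ler_sum => k _ /=; rewrite -natrD ler_nat.
by case: (leP (a k) v2); case: (leP (a k) v1) => //;
  rewrite ?addn1 // => /ltW ->.
Qed.

End Levels.

Section Excess.
Variables (R : realType) (F f : R -> R).
Hypotheses (hinc : increment_bounds F f) (hf : even_unimodal f).
Hypothesis f_ge0 : forall v, 0 <= f v.

(** Indices with a shift of at least e contribute a fixed excess at the
    thresholds near e; all others contribute at least what they do at 0. *)
Lemma excess_exceedances (n : nat) (t : 'I_n -> R) (b e : R) : 0 < e -> 0 < b ->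
  n%:R * (1 - window F b 0) +
    e / 2 * (f (3 / 4 * e) - f e) * (\sum_(i < n) (e <= `|t i|)%R%:R) *
    (e <= b <= 5 / 4 * e)%R%:R <=
  \sum_(i < n) (1 - window F b (t i)).
Proof.
move=> e0 b0; set c := e / 2 * _.
have -> : n%:R * (1 - window F b 0) = \sum_(i < n) (1 - window F b 0).
  by rewrite sumr_const card_ord mulr_natl.
rewrite mulr_sumr mulr_suml -big_split; apply: ler_sum => i _ /=.
have h := window_centred hinc hf f_ge0 (t i) b0.
case: (boolP (e <= `|t i|)) => et;
  last by rewrite mulr0 mul0r addr0 lerD2l lerN2.
case: (boolP (e <= b <= _)) => [/andP[eb be]|_];
  last by rewrite mulr0 addr0 lerD2l lerN2.
by have := window_gap hinc hf f_ge0 e0 et eb be; rewrite -/c !mulr1; lra.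
Qed.

End Excess.

Unset Implicit Arguments.

Theorem theorem4p3
  (R : realType) (d : measure_display) (Omega : measurableType d)
  (P : probability Omega R)
  (p : nat -> nat)
  (x : forall n, 'I_n -> 'cV[R]_(p n))
  (beta0 : forall n, 'cV[R]_(p n))
  (F0 f0 : R -> R)
  (u : forall n, 'I_n -> {RV P >-> R})
  (y : forall n, 'I_n -> Omega -> R)
  (s : nat -> {RV P >-> R}) (s0 : R)
  (rho1 : R -> R)
  (betahat : forall n, Omega -> 'cV[R]_(p n))
  (hp : forall n, (0 < n)%N -> (0 < p n)%N)
  (hSigma : forall n, (0 < n)%N -> design_cov (x n) \in unitmx)
  (hu : forall n, iid (u n) F0)
  (hy : forall n i w, y n i w = dotv (x n i) (beta0 n) + u n i w)
  (hs : forall n w, 0 < s n w)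
  (hs0 : 0 < s0)
  (hscvg : cvg_in_probability P (fun n => s n : Omega -> R) s0)
  (hbeta_meas : forall n, random_vector (betahat n))
  (hbeta_min : forall n w,
     is_minimizer (m_objective rho1 (x n) (fun i => y n i w) (s n w))
                  (betahat n w))
  (hrho : rho_function rho1)
  (hrho_bounded : bounded_fun rho1)
  (hrho_C1 : continuously_differentiable rho1)
  (hpsi_bounded : bounded_fun (derive1 rho1))
  (htpsi_bounded : bounded_fun (fun t : R => t * derive1 rho1 t))
  (hF0 : has_density F0 f0)
  (hf0 : even_unimodal f0)
  (hpn : (p n)%:R / n%:R @[n --> \oo] --> (0 : R))
  (alpha : R) (halpha0 : 0 < alpha) (halpha1 : alpha < 1) :
  cvg_in_probability P
    (fun n w => eta_n (x n) alpha * enorm (betahat n w - beta0 n)) 0.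
Proof.
have hinc := density_increments hF0.
have f_ge0 : forall v, 0 <= f0 v by have [] := hF0.
move=> eps eps0.
have [dr dr0 hdr] := rho_increasing_near0 hrho hrho_bounded.
have [_ _ [df df0 hdf]] := hf0.
(* e replaces eps: below df / 2 the density, and below s0 * dr / 2 the loss, is
   strictly monotone on the whole range up to 5 / 4 * e *)
pose e := Num.min eps (Num.min (df / 2) (s0 * dr / 2)).
have sdr : 0 < s0 * dr by rewrite mulr_gt0.
have e0 : 0 < e by rewrite !lt_min eps0; lra.
have e_eps : e <= eps by rewrite ge_min lexx.
have e_df : e <= df / 2 by rewrite !ge_min lexx orbT.
have e_dr : e <= s0 * dr / 2 by rewrite !ge_min lexx !orbT.
pose c := e / 2 * (f0 (3 / 4 * e) - f0 e).
have c0 : 0 < c.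
  rewrite mulr_gt0 //; first lra.
  by rewrite subr_gt0; apply: hdf; rewrite !ger0_norm; clear -df0 e0 e_df; lra.
pose g := rho1 (5 / 4 * e / s0) - rho1 (e / s0).
have g0 : 0 < g.
  rewrite subr_gt0; apply: hdr; first by rewrite divr_ge0 ?ltW.
    by rewrite ltr_pM2r ?invr_gt0 //; lra.
  by rewrite ltr_pdivrMr //; lra.
have ca0 : 0 < c * (1 - alpha) by rewrite mulr_gt0 //; lra.
(* so many levels that the excess beats both the loss of one level per index
   (a term n) and the deviations 4 * m * e' * n <= n, with a margin n *)
pose m := Num.truncn ((3 / (c * (1 - alpha)) + 1) / g).
have hm : 3 < c * (1 - alpha) * (m.+1%:R * g - 1).
  rewrite mulrC -ltr_pdivrMr // ltrBrDr -ltr_pdivrMr //; exact: truncnS_gt.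
have [a a0 cake] := layer_cake hrho hrho_bounded m.
have m0 : 0 < m.+1%:R :> R by rewrite ltr0n.
pose e' : R := (4 * m.+1%:R)^-1.
have e'0 : 0 < e' by rewrite invr_gt0 mulr_gt0.
have me' : 4 * m%:R * e' <= 1.
  by rewrite ler_pdivrMr ?mulr_gt0 // mul1r ler_pM2l // ler_nat.
have f00 := f_ge0 0.
pose A := \sum_(k < m) a k.
have A0 : 0 <= A by apply: sumr_ge0 => k _; exact: ltW.
have aA k : a k <= A.
  by rewrite /A (bigD1 k) //= lerDl sumr_ge0 // => j _; exact: ltW.
(* moving s_n by del changes no window by more than e' *)
pose del := Num.min (s0 / 2) (e' / (2 * f0 0 * A + 1)).
have D0 : 0 < 2 * f0 0 * A + 1 by rewrite ltr_wpDl // !mulr_ge0.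
have del0 : 0 < del by rewrite lt_min !divr_gt0.
have del_s0 : del <= s0 / 2 by rewrite ge_min lexx.
have delA k : 2 * f0 0 * (del * a k) <= e'.
  have : del * (2 * f0 0 * A + 1) <= e'
    by rewrite -ler_pdivlMr // ge_min lexx orbT.
  have : del * (2 * f0 0 * a k) <= del * (2 * f0 0 * A).
    by rewrite ler_pM2l // ler_wpM2l // mulr_ge0.
  lra.
have lo0 k : 0 < (s0 - del) * a k.
  by rewrite mulr_gt0 //; clear -hs0 del_s0; lra.
have hi0 k : 0 < (s0 + del) * a k by rewrite mulr_gt0 //; clear -hs0 del0; lra.
have W := whpI (whp_cvg_in_probability hscvg del0) (whpI
  (whp_forall (fun k => lower_law hinc hf0 f_ge0 x hu hpn (hi0 k) e'0))
  (whp_forall (fun k => upper_law hinc hf0 f_ge0 hu (lo0 k) e'0))).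
apply: (cvg0_of_whp W) => [n|].
  apply: (@measurable_superlevel _ _ _ (fun w =>
    `|eta_n (x n) alpha * enorm (betahat n w - beta0 n) - 0|)).
  apply: measurableT_comp => //; apply: measurable_funB => //.
  by apply: measurable_funM => //; exact: measurable_enorm.
near=> n => w [/= hsw [hlow hupp]].
have n0 : 0 < n%:R :> R by rewrite ltr0n; near: n; exact: nbhs_infty_gt.
apply/negP; rewrite -leNgt subr0 leNgt; apply/negP.
rewrite ger0_norm ?mulr_ge0 ?eta_n_ge0 ?sqrtr_ge0 // => hbig.
have G1 := eta_n_large (ltW halpha0) eps0 hbig.
set v := betahat n w - beta0 n in hbig G1.
pose t i := dotv (x n i) v.
have sw := hs n w.
have [s_lo s_hi] : s0 - del <= s n w /\ s n w <= s0 + del.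
  by clear -hsw; move: hsw; rewrite ler_norml => /andP[]; lra.
have G2 : n%:R * (1 - alpha) <= \sum_(i < n) (e <= `|t i|)%R%:R.
  apply: le_trans G1 _; apply: ler_sum => i _; rewrite -/(t i).
  by case: (leP eps) => // h; rewrite (le_trans e_eps h).
have obj : \sum_(i < n) rho1 ((u n i w - t i) / s n w) <=
           \sum_(i < n) rho1 (u n i w / s n w).
  have := hbeta_min n w (beta0 n); rewrite /m_objective.
  under eq_bigr => i _.
    rewrite hy (_ : _ - _ = u n i w - t i); last by rewrite /t dotvB; ring.
    over.
  under [in leRHS]eq_bigr => i _ do rewrite hy addrAC subrr add0r.
  by [].
have ex := exceedances_of_objective cake sw obj.
have low k : n%:R * (1 - window F0 (s0 * a k) 0) +
    c * (\sum_(i < n) (e <= `|t i|)%R%:R) * (e <= s0 * a k <= 5 / 4 * e)%R%:R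
    - 2 * n%:R * e' <= \sum_(i < n) (s n w * a k <= `|u n i w - t i|)%R%:R.
  have h1 := hlow k v.
  have h2 : \sum_(i < n) ((s0 + del) * a k <= `|u n i w - dotv (x n i) v|)%R%:R
      <= \sum_(i < n) (s n w * a k <= `|u n i w - t i|)%R%:R :> R.
    apply: ler_sum => i _; rewrite -/(t i);
      case: (leP ((s0 + del) * a k)) => // h.
    by rewrite (le_trans _ h) // ler_pM2r.
  have h3 := excess_exceedances hinc hf0 f_ge0 t e0 (mulr_gt0 hs0 (a0 k)).
  have h4 : \sum_(i < n) (1 - window F0 (s0 * a k) (t i)) - n%:R * e' <=
      \sum_(i < n) (1 - window F0 ((s0 + del) * a k) (dotv (x n i) v)).
    have -> : n%:R * e' = \sum_(i < n) e'
      by rewrite sumr_const card_ord mulr_natl.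
    rewrite -sumrB; apply: ler_sum => i _; rewrite -/(t i).
    have := window_width hinc hf0 f_ge0 (s0 * a k) ((s0 + del) * a k) (t i).
    have -> : `|(s0 + del) * a k - s0 * a k| = del * a k.
      clear -del0 a0; rewrite ger0_norm; first by ring.
      by rewrite -mulrBl addrAC subrr add0r mulr_ge0 // ltW.
    have := delA k; clear; rewrite ler_norml => ? /andP[]; lra.
  rewrite -/c in h3; clear -h1 h2 h3 h4; lra.
have upp k : \sum_(i < n) (s n w * a k <= `|u n i w|)%R%:R <=
    n%:R * (1 - window F0 (s0 * a k) 0) + 2 * n%:R * e'.
  have h1 := hupp k.
  have h2 : \sum_(i < n) (s n w * a k <= `|u n i w|)%R%:R <=
      \sum_(i < n) ((s0 - del) * a k <= `|u n i w|)%R%:R :> R.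
    apply: ler_sum => i _; case: (leP (s n w * a k)) => // h.
    by rewrite (le_trans _ h) // ler_pM2r.
  have h3 : window F0 (s0 * a k) 0 - e' <= window F0 ((s0 - del) * a k) 0.
    have := window_width hinc hf0 f_ge0 (s0 * a k) ((s0 - del) * a k) 0.
    have -> : `|(s0 - del) * a k - s0 * a k| = del * a k.
      clear -del0 a0; rewrite ler0_norm; first by ring.
      by rewrite -mulrBl addrAC subrr add0r mulNr oppr_le0 mulr_ge0 // ltW.
    have := delA k; clear; rewrite ler_norml => ? /andP[]; lra.
  have h4 : n%:R * (window F0 (s0 * a k) 0 - e') <=
    n%:R * window F0 ((s0 - del) * a k) 0 by rewrite ler_pM2l.
  clear -h1 h2 h4; lra.
have H : m.+1%:R * g - 1 <= \sum_(k < m) (e <= s0 * a k <= 5 / 4 * e)%R%:R.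
  have e1 : 0 <= e / s0 by rewrite divr_ge0 ?ltW.
  have e2 : e / s0 <= 5 / 4 * e / s0
    by rewrite ler_pM2r ?invr_gt0 //; clear -e0; lra.
  apply: le_trans (levels_between cake e1 e2) _; apply: ler_sum => k _.
  by rewrite ler_pdivrMr // ler_pdivlMr // [a k * s0]mulrC.
have key : \sum_(k < m) (c * (\sum_(i < n) (e <= `|t i|)%R%:R) *
      (e <= s0 * a k <= 5 / 4 * e)%R%:R - 4 * n%:R * e') <= n%:R.
  have -> : n%:R =
    (\sum_(k < m) \sum_(i < n) (s n w * a k <= `|u n i w|)%R%:R + n%:R) -
    \sum_(k < m) \sum_(i < n) (s n w * a k <= `|u n i w|)%R%:R :> R by ring.
  apply: le_trans (lerB ex (lexx _)); rewrite -sumrB; apply: ler_sum => k _.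
  have := low k; have := upp k; clear; lra.
move: key; rewrite sumrB -mulr_sumr sumr_const card_ord -[_ *+ m]mulr_natl.
set G := \sum_(i < n) _ in G2 *; set L := \sum_(k < m) _ in H *; move=> key.
have k1 : c * (n%:R * (1 - alpha)) <= c * G by rewrite ler_pM2l.
have Lpos : 0 < m.+1%:R * g - 1.
  by rewrite -(pmulr_rgt0 _ ca0) (lt_trans _ hm).
have k2 : c * (n%:R * (1 - alpha)) * (m.+1%:R * g - 1) <= c * G * L.
  apply: ler_pM => //; last exact: ltW.
  by rewrite mulrCA mulr_ge0 ?(ltW n0) ?(ltW ca0).
have k3 : n%:R * 3 < n%:R * (c * (1 - alpha) * (m.+1%:R * g - 1))
  by rewrite ltr_pM2l.
have k4 : n%:R * (4 * m%:R * e') <= n%:R * 1 by rewrite ler_pM2l.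
clear -n0 key k1 k2 k3 k4; lra.
Unshelve. all: by end_near.
Qed.
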